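(* Assume that the parameter $\epsilon$ in the definition of the active-set estimate $A_{\ell_1}(\cdot)$ satisfies $0<\epsilon\le\frac{1}{\tau^2nL(2C+1)}$, where $C>0$ is a given constant. Given a feasible non-stationary point $x$ of the problem $\min\{\varphi(x):x\in\mathbb{R}^n,\ \|x\|_1\le\tau\}$, let $j\in J_{\ell_1}(x)$ and $I=\{1,\dots,n\}\setminus\{j\}$. Let $\hat A_{\ell_1}(x)$ be a set of indices such that $\hat A_{\ell_1}(x)\subseteq A_{\ell_1}(x)$. Let $\tilde x$ be the feasible point defined by $$\tilde x_{\hat A_{\ell_1}(x)}=0;\qquad \tilde x_{I\setminus\hat A_{\ell_1}(x)}=x_{I\setminus\hat A_{\ell_1}(x)};\qquad \tilde x_j=x_j-\operatorname{sgn}(\nabla_j\varphi(x))\sum_{h\in\hat A_{\ell_1}(x)}|x_h|.$$ Then $$\varphi(\tilde x)-\varphi(x)\le -CL\|\tilde x-x\|^2.$$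
   Context: $\varphi\colon\mathbb{R}^n\to\mathbb{R}$ is a differentiable function whose gradient is Lipschitz continuous with constant $L>0$ (w.r.t. the Euclidean norm $\|\cdot\|$), and $\tau>0$. $e_i$ denotes the $i$-th canonical vector of $\mathbb{R}^n$; for an index set $S$, $x_S$ is the subvector of $x$ with indices in $S$. A feasible point $x^*$ is stationary iff $\nabla\varphi(x^* )^T(\tau e_i-x^* )\ge 0$ and $\nabla\varphi(x^* )^T(-\tau e_i-x^* )\ge 0$ for all $i=1,\dots,n$. For $\epsilon>0$ and feasible $x$, $A_{\ell_1}(x)$ is the set of $i\in\{1,\dots,n\}$ such that $$\epsilon\tau\nabla\varphi(x)^T(\tau e_i+x)\le 0\le x_i\le \epsilon\tau\nabla\varphi(x)^T(\tau e_i-x)\quad\text{or}\quad \epsilon\tau\nabla\varphi(x)^T(\tau e_i+x)\le x_i\le 0\le \epsilon\tau\nabla\varphi(x)^T(\tau e_i-x).$$ Moreover, $J_{\ell_1}(x)=\{j : j\in\operatorname{Argmax}_{i=1,\dots,n}|\nabla_i\varphi(x)|\}$. *)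

(* Defs.v *)
From HB Require Import structures.
From mathcomp Require Import all_boot all_order all_algebra.
From mathcomp Require Import all_classical all_reals all_analysis.

Set Implicit Arguments.
Unset Strict Implicit.
Unset Printing Implicit Defensive.

Import Order.TTheory GRing.Theory Num.Theory.
Import numFieldNormedType.Exports.

Local Open Scope ring_scope.

(* Vectors of R^n are row vectors. The library norm `|x| on 'rV[R]_n is the
   sup norm, so the l1 and Euclidean norms are defined here; differentiability
   does not depend on the choice of norm in finite dimension. *)

Definition evec (R : realType) (n : nat) (i : 'I_n) : 'rV[R]_n :=
  delta_mx 0 i.

Definition dotv (R : realType) (n : nat) (u v : 'rV[R]_n) : R :=
  \sum_(i < n) u 0 i * v 0 i.

Definition norm1 (R : realType) (n : nat) (x : 'rV[R]_n) : R :=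
  \sum_(i < n) `|x 0 i|.

Definition norm2 (R : realType) (n : nat) (x : 'rV[R]_n) : R :=
  Num.sqrt (dotv x x).

Definition grad (R : realType) (n : nat) (phi : 'rV[R]_n -> R)
    (x : 'rV[R]_n) : 'rV[R]_n :=
  \row_(i < n) 'D_(evec R i) phi x.

Definition lipschitz_grad (R : realType) (n : nat) (L : R)
    (phi : 'rV[R]_n -> R) : Prop :=
  forall x y : 'rV[R]_n,
    norm2 (grad phi x - grad phi y) <= L * norm2 (x - y).

Definition feasible (R : realType) (n : nat) (tau : R) (x : 'rV[R]_n) : Prop :=
  norm1 x <= tau.

(* Stationarity on the l1 ball, tested at its vertices +-tau e_i; to be used
   together with [feasible]. *)
Definition stationary (R : realType) (n : nat) (tau : R)
    (phi : 'rV[R]_n -> R) (x : 'rV[R]_n) : Prop :=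
  forall i : 'I_n,
    0 <= dotv (grad phi x) (tau *: evec R i - x) /\
    0 <= dotv (grad phi x) (- (tau *: evec R i) - x).

Definition active_l1 (R : realType) (n : nat) (tau eps : R)
    (phi : 'rV[R]_n -> R) (x : 'rV[R]_n) : {set 'I_n} :=
  [set i : 'I_n |
     let lo := eps * tau * dotv (grad phi x) (tau *: evec R i + x) in
     let hi := eps * tau * dotv (grad phi x) (tau *: evec R i - x) in
     [&& lo <= 0, 0 <= x 0 i & x 0 i <= hi]
     || [&& lo <= x 0 i, x 0 i <= 0 & 0 <= hi]].

Definition J_l1 (R : realType) (n : nat) (phi : 'rV[R]_n -> R)
    (x : 'rV[R]_n) : {set 'I_n} :=
  [set j : 'I_n | [forall i : 'I_n, `|grad phi x 0 i| <= `|grad phi x 0 j|]].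

(* The point obtained from x by zeroing the coordinates in A and moving their
   total mass to coordinate j. The order of the two tests is immaterial where
   this is used: at a non-stationary x, no j in J_l1 lies in active_l1. *)
Definition xtilde (R : realType) (n : nat) (phi : 'rV[R]_n -> R)
    (x : 'rV[R]_n) (j : 'I_n) (A : {set 'I_n}) : 'rV[R]_n :=
  \row_(h < n)
    if h == j then x 0 j - Num.sg (grad phi x 0 j) * \sum_(k in A) `|x 0 k|
    else if h \in A then 0
    else x 0 h.

(* Main.v *)
(** With [g] the gradient and [d = xtilde - x], the active-set conditions and
    non-stationarity ([- tau |g_j| < g.x]) give, for every active index [h],
    [g_h x_h + |g_j| |x_h| >= x_h^2 / (eps tau^2)]; summing,
    [g.d <= - sum_h x_h^2 / (eps tau^2)].  Since [j] is not active, at most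
    [n - 1] coordinates are zeroed, so [|d|^2 <= n sum_h x_h^2], hence
    [g.d <= - L (2C+1) |d|^2].  The mean value theorem and the Lipschitz
    condition give [phi (x + d) - phi x <= g.d + L |d|^2]. *)

Require Import Defs.
From HB Require Import structures.
From mathcomp Require Import all_boot all_order all_algebra.
From mathcomp Require Import all_classical all_reals all_analysis.
From mathcomp Require Import ring lra.

Set Implicit Arguments.
Unset Strict Implicit.
Unset Printing Implicit Defensive.

Import Order.TTheory GRing.Theory Num.Theory.
Import numFieldNormedType.Exports.

Local Open Scope ring_scope.

(** * Dot product and Euclidean norm *)

Lemma dotvDr (R : realType) (n : nat) (u v w : 'rV[R]_n) :
  dotv u (v + w) = dotv u v + dotv u w.
Proof. by rewrite /dotv -big_split; apply: eq_bigr => i _; rewrite mxE mulrDr. Qed.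

Lemma dotvBr (R : realType) (n : nat) (u v w : 'rV[R]_n) :
  dotv u (v - w) = dotv u v - dotv u w.
Proof.
by rewrite /dotv -sumrB; apply: eq_bigr => i _; rewrite !mxE mulrBr.
Qed.

Lemma dotvBl (R : realType) (n : nat) (u v w : 'rV[R]_n) :
  dotv (u - v) w = dotv u w - dotv v w.
Proof.
by rewrite /dotv -sumrB; apply: eq_bigr => i _; rewrite !mxE mulrBl.
Qed.

Lemma dotvZe (R : realType) (n : nat) (u : 'rV[R]_n) (a : R) (i : 'I_n) :
  dotv u (a *: evec R i) = a * u 0 i.
Proof.
rewrite /dotv (bigD1 i) //= big1 ?addr0 => [|k ki].
  by rewrite !mxE !eqxx mulr1 mulrC.
by rewrite !mxE (negbTE ki) andbF !mulr0.
Qed.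

Lemma dotvv_ge0 (R : realType) (n : nat) (u : 'rV[R]_n) : 0 <= dotv u u.
Proof. by apply: sumr_ge0 => i _; rewrite -expr2 sqr_ge0. Qed.

Lemma norm2_ge0 (R : realType) (n : nat) (u : 'rV[R]_n) : 0 <= norm2 u.
Proof. exact: sqrtr_ge0. Qed.

Lemma sqr_norm2 (R : realType) (n : nat) (u : 'rV[R]_n) :
  norm2 u ^+ 2 = dotv u u.
Proof. by rewrite sqr_sqrtr // dotvv_ge0. Qed.

Lemma norm2Z (R : realType) (n : nat) (a : R) (u : 'rV[R]_n) :
  norm2 (a *: u) = `|a| * norm2 u.
Proof.
rewrite /norm2 -sqrtr_sqr -sqrtrM ?sqr_ge0 //; congr Num.sqrt.
rewrite /dotv mulr_sumr; apply: eq_bigr => i _.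
by rewrite !mxE; ring.
Qed.

(** Takes the place of Cauchy-Schwarz: expand [0 <= |u - a v|^2], bound [|u|^2] by [a^2 |v|^2], and
    divide by [2 a]. *)
Lemma dotv_le_of_norm2_le (R : realType) (n : nat) (a : R) (u v : 'rV[R]_n) :
  0 < a -> norm2 u <= a * norm2 v -> dotv u v <= a * norm2 v ^+ 2.
Proof.
move=> a0 uv.
have : 0 <= dotv (u - a *: v) (u - a *: v) by exact: dotvv_ge0.
have -> : dotv (u - a *: v) (u - a *: v) =
          dotv u u - 2 * a * dotv u v + a ^+ 2 * dotv v v.
  rewrite /dotv !mulr_sumr -sumrB -big_split /=.
  by apply: eq_bigr => i _; rewrite !mxE; ring.
rewrite -!sqr_norm2 => sq.
have uv2 : norm2 u ^+ 2 <= (a * norm2 v) ^+ 2.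
  by rewrite ler_sqr // nnegrE ?mulr_ge0 ?norm2_ge0 // ltW.
rewrite -(ler_pM2l a0); lra.
Qed.

(** * Gradient and descent inequality *)

Lemma derive_dotv (R : realType) (n : nat) (phi : 'rV[R]_n -> R)
  (z v : 'rV[R]_n) :
  differentiable phi z -> 'D_v phi z = dotv (grad phi z) v.
Proof.
move=> dphi; rewrite deriveE // [in LHS](row_sum_delta v) linear_sum.
apply: eq_bigr => i _; rewrite linearZ /= mxE deriveE //.
exact: mulrC.
Qed.

(** The difference quotients along the line at [t] are those of [phi] at [x + t *: d] in direction
    [d]. *)
Lemma is_derive_line (R : realType) (V : normedModType R) (phi : V -> R)
  (x d : V) (t : R) :
  differentiable phi (x + t *: d) ->
  is_derive t 1 (fun s : R => phi (x + s *: d)) ('D_d phi (x + t *: d)).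
Proof.
move=> dphi.
have E : (fun h : R => h^-1 *: (((fun s : R => phi (x + s *: d)) \o shift t)
             (h *: 1) - phi (x + t *: d)))
       = (fun h : R => h^-1 *: ((phi \o shift (x + t *: d)) (h *: d)
             - phi (x + t *: d))).
  apply/funext => h /=; congr (_ *: (phi _ - _)).
  by rewrite [h *: 1]mulr1 scalerDl addrCA.
have D : derivable phi (x + t *: d) d by exact: diff_derivable.
by apply: DeriveDef; rewrite /derivable /derive E.
Qed.

(** The constant is [L] rather than the sharp [L / 2], since the mean value theorem only gives some
    [t] in [(0, 1)], which is then bounded by [1]. *)
Lemma descent (R : realType) (n : nat) (phi : 'rV[R]_n -> R) (L : R)
  (x d : 'rV[R]_n) :
  0 < L -> (forall z, differentiable phi z) -> lipschitz_grad L phi ->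
  phi (x + d) - phi x <= dotv (grad phi x) d + L * norm2 d ^+ 2.
Proof.
move=> L0 dphi lip.
have D (t : R) : is_derive t 1 (fun s : R => phi (x + s *: d))
                     ('D_d phi (x + t *: d)) by exact: is_derive_line.
have [|t] := @MVT R (fun s : R => phi (x + s *: d))
    (fun s : R => 'D_d phi (x + s *: d)) 0 1 ltr01.
  by apply: derivable_within_continuous => t _; apply: ex_derive.
rewrite in_itv /= => /andP[t0 t1].
rewrite scale1r scale0r addr0 subr0 mulr1 derive_dotv // => ->.
have := lip (x + t *: d) x.
rewrite [_ - x]addrC addKr norm2Z gtr0_norm // mulrA => lipt.
have := dotv_le_of_norm2_le (mulr_gt0 L0 t0) lipt.
rewrite dotvBl => h.
have : L * t * norm2 d ^+ 2 <= L * norm2 d ^+ 2.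
  by rewrite ler_wpM2r ?sqr_ge0 // ler_piMr ?ltW.
lra.
Qed.

(** * The displacement from [x] to [xtilde] *)

(** With [m] the cardinal and [S] the sum, the nonnegative sum of [(m a_i - S)^2] equals [m] times
    the difference of the two sides. *)
Lemma sqr_sum_le_card (R : realFieldType) (I : finType) (A : {set I})
  (a : I -> R) :
  (\sum_(i in A) a i) ^+ 2 <= #|A|%:R * \sum_(i in A) a i ^+ 2.
Proof.
have [->|A0] := eqVneq A finset.set0.
  by rewrite !big_set0 cards0 mul0r expr0n.
have m0 : 0 < #|A|%:R :> R by rewrite ltr0n card_gt0.
have eS c : \sum_(i in A) c = #|A|%:R * c :> R by rewrite sumr_const mulr_natl.
set m : R := #|A|%:R in m0 eS *; set S := \sum_(i in A) a i.
have : 0 <= \sum_(i in A) (m * a i - S) ^+ 2.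
  by apply: sumr_ge0 => i _; rewrite sqr_ge0.
have -> : \sum_(i in A) (m * a i - S) ^+ 2 =
    m ^+ 2 * (\sum_(i in A) a i ^+ 2) - (2 * m * S) * S + m * S ^+ 2.
  rewrite -eS [(_ * _) * S]mulr_sumr mulr_sumr -sumrB -big_split /=.
  by apply: eq_bigr => i _; ring.
by move=> h; rewrite -(ler_pM2l m0); lra.
Qed.

(** Zeroing [A] frees the mass [S], and coordinate [j] grows by at most [S] in absolute value. *)
Lemma norm1_xtilde_le (R : realType) (n : nat) (phi : 'rV[R]_n -> R)
  (x : 'rV[R]_n) (j : 'I_n) (A : {set 'I_n}) :
  j \notin A -> norm1 (xtilde phi x j A) <= norm1 x.
Proof.
move=> jA; rewrite /norm1 (bigD1 j) //= [leRHS](bigD1 j) //=.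
rewrite [X in `|X| + _ <= _]mxE eqxx.
set s := Num.sg _; set S := \sum_(k in A) `|x 0 k|.
have -> : \sum_(i | i != j) `|xtilde phi x j A 0 i| =
          \sum_(i | (i != j) && (i \notin A)) `|x 0 i|.
  rewrite [LHS](bigID (mem A)) /= big1 ?add0r => [|i /andP[/negbTE ij iA]].
    by apply: eq_bigr => i /andP[/negbTE ij /negbTE iA]; rewrite mxE ij iA.
  by rewrite mxE ij iA normr0.
have -> : \sum_(i | i != j) `|x 0 i| =
          S + \sum_(i | (i != j) && (i \notin A)) `|x 0 i|.
  rewrite [LHS](bigID (mem A)) /=; congr (_ + _); apply: eq_bigl => i.
  by case: eqVneq => [->|]//=; rewrite (negbTE jA).
rewrite addrA lerD2r (le_trans (ler_normB _ _)) // lerD2l normrM.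
have S0 : 0 <= S by exact: sumr_ge0.
by rewrite (ger0_norm S0) ler_piMl // normr_sg lern1 leq_b1.
Qed.

(** Stated for a general [f] so as to serve both the linear form [g_i y] and the square [y * y]. *)
Lemma sum_xtilde_sub (R : realType) (n : nat) (phi : 'rV[R]_n -> R)
  (x : 'rV[R]_n) (j : 'I_n) (A : {set 'I_n}) (f : 'I_n -> R -> R) :
  j \notin A -> (forall i, f i 0 = 0) ->
  \sum_i f i ((xtilde phi x j A - x) 0 i) =
  f j (- (Num.sg (grad phi x 0 j) * \sum_(i in A) `|x 0 i|))
  + \sum_(i in A) f i (- x 0 i).
Proof.
move=> jA f0; rewrite (bigD1 j) //=.
congr (f j _ + _); first by rewrite !mxE eqxx addrAC subrr sub0r.
rewrite (bigID (mem A)) /= addrC big1 ?add0r.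
  apply: eq_big => [i|i /andP[/negbTE ij iA]].
    by case: eqVneq => [->|]//=; rewrite (negbTE jA).
  by rewrite !mxE ij iA sub0r.
by move=> i /andP[/negbTE ij /negbTE iA]; rewrite !mxE ij iA subrr f0.
Qed.

Lemma dotv_grad_xtilde_sub (R : realType) (n : nat) (phi : 'rV[R]_n -> R)
  (x : 'rV[R]_n) (j : 'I_n) (A : {set 'I_n}) :
  j \notin A ->
  dotv (grad phi x) (xtilde phi x j A - x) =
  - \sum_(i in A) (grad phi x 0 i * x 0 i + `|grad phi x 0 j| * `|x 0 i|).
Proof.
move=> jA.
rewrite /dotv (sum_xtilde_sub _ _ (f := fun i y => grad phi x 0 i * y)) //.
  rewrite big_split /= -mulr_sumr normrEsg opprD addrC.
  congr (_ + _); last by ring.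
  by rewrite -sumrN; apply: eq_bigr => i _; rewrite mulrN.
by move=> i; rewrite mulr0.
Qed.

Lemma sqr_norm2_xtilde_sub_le (R : realType) (n : nat) (phi : 'rV[R]_n -> R)
  (x : 'rV[R]_n) (j : 'I_n) (A : {set 'I_n}) :
  j \notin A ->
  norm2 (xtilde phi x j A - x) ^+ 2 <= n%:R * \sum_(i in A) x 0 i ^+ 2.
Proof.
move=> jA; rewrite sqr_norm2 /dotv.
rewrite (sum_xtilde_sub _ _ (f := fun i y => y * y)) //; last first.
  by move=> i; rewrite mulr0.
rewrite -expr2 sqrrN exprMn.
under [X in _ + X <= _]eq_bigr => i _ do rewrite mulrNN -expr2.
set Q := \sum_(i in A) _ ^+ 2; set S := \sum_(i in A) _.
have SQ : S ^+ 2 <= #|A|%:R * Q.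
  apply: (le_trans (sqr_sum_le_card _ _)).
  by under eq_bigr => i _ do rewrite real_normK ?num_real //.
have Q0 : 0 <= Q by apply: sumr_ge0 => i _; exact: sqr_ge0.
have sS : Num.sg (grad phi x 0 j) ^+ 2 * S ^+ 2 <= S ^+ 2.
  by rewrite ler_piMl ?sqr_ge0 // sqr_sg lern1 leq_b1.
(* The extra [1] pays for the move of coordinate [j]; it fits because [j] lies outside [A]. *)
have cardA : #|A|%:R + 1 <= n%:R :> R.
  rewrite natr1 ler_nat -[leqRHS]card_ord.
  by apply: proper_card; apply/properP; split; [exact/fintype.subsetP|exists j].
have := ler_wpM2r Q0 cardA; lra.
Qed.

(** * Consequences of non-stationarity *)

(** Otherwise [g.x <= - tau |g_j| <= - tau |g_i|] for all [i] by maximality of [|g_j|], and every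
    vertex test of stationarity holds. *)
Lemma nonstationary_gt (R : realType) (n : nat) (tau : R)
  (phi : 'rV[R]_n -> R) (x : 'rV[R]_n) (j : 'I_n) :
  0 < tau -> ~ stationary tau phi x -> j \in J_l1 phi x ->
  - (tau * `|grad phi x 0 j|) < dotv (grad phi x) x.
Proof.
move=> tau0 nst; rewrite inE => /forallP jmax; rewrite ltNge; apply/negP => le.
apply: nst => i; rewrite -scaleNr !dotvBr !dotvZe.
have := ler_wpM2l (ltW tau0) (jmax i).
have := ler_norm (tau * grad phi x 0 i).
have := ler_norm (- (tau * grad phi x 0 i)).
by rewrite normrN normrM (gtr0_norm tau0); split; lra.
Qed.

(** Both alternatives force [lo <= 0 <= hi]; at [j], [lo > 0] if [g_j >= 0], and [hi < 0]
    otherwise. *)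
Lemma notin_active_l1 (R : realType) (n : nat) (tau eps : R)
  (phi : 'rV[R]_n -> R) (x : 'rV[R]_n) (j : 'I_n) :
  0 < tau -> 0 < eps -> ~ stationary tau phi x -> j \in J_l1 phi x ->
  j \notin active_l1 tau eps phi x.
Proof.
move=> tau0 eps0 nst jJ; have := nonstationary_gt tau0 nst jJ.
have et0 : 0 < eps * tau by rewrite mulr_gt0.
rewrite inE /= dotvDr dotvBr dotvZe.
set a := dotv _ _; set g := grad phi x 0 j => ga.
apply/negP; case: (lerP 0 g) => g0.
  rewrite ger0_norm // in ga.
  have lo : 0 < eps * tau * (tau * g + a) by rewrite mulr_gt0 //; lra.
  by case/orP => /and3P[]; lra.
rewrite ltr0_norm // in ga.
have hi : eps * tau * (tau * g - a) < 0 by rewrite pmulr_rlt0 //; lra.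
by case/orP => /and3P[]; lra.
Qed.

Lemma active_l1_decrease (R : realType) (n : nat) (tau eps : R)
  (phi : 'rV[R]_n -> R) (x : 'rV[R]_n) (j i : 'I_n) :
  0 < tau -> 0 < eps -> ~ stationary tau phi x -> j \in J_l1 phi x ->
  i \in active_l1 tau eps phi x ->
  x 0 i ^+ 2 <=
  eps * tau ^+ 2 * (grad phi x 0 i * x 0 i + `|grad phi x 0 j| * `|x 0 i|).
Proof.
move=> tau0 eps0 nst jJ; have := nonstationary_gt tau0 nst jJ.
have et0 : 0 < eps * tau by rewrite mulr_gt0.
rewrite inE /= dotvDr dotvBr dotvZe.
set a := dotv _ _; set g := grad phi x 0 i; set m := `|_|; set y := x 0 i.
(* Adding this nonnegative quantity to the active-set bound on [|y|] cancels the unknown [a = g.x];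
   multiplying by [|y|] then gives the claim. *)
move=> ma; have {}ma : 0 <= eps * tau * (tau * m + a).
  by apply: mulr_ge0; [exact: ltW|lra].
case/orP => /and3P[lo xi hi].
- rewrite (ger0_norm xi).
  have : y <= eps * tau * (tau * (g + m)) by lra.
  by move=> /(ler_wpM2l xi) h; lra.
- rewrite (ler0_norm xi).
  have : - y <= eps * tau * (tau * (m - g)) by lra.
  have xi' : 0 <= - y by lra.
  by move=> /(ler_wpM2l xi') h; lra.
Qed.

Theorem proposition2p7 (R : realType) (n : nat) (phi : 'rV[R]_n -> R)
  (L tau C eps : R)
  (L_gt0 : 0 < L) (tau_gt0 : 0 < tau) (C_gt0 : 0 < C)
  (phi_diff : forall z : 'rV[R]_n, differentiable phi z)
  (phi_lip : lipschitz_grad L phi)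
  (eps_gt0 : 0 < eps)
  (eps_le : eps <= 1 / (tau ^+ 2 * n%:R * L * (2 * C + 1)))
  (x : 'rV[R]_n) (x_feas : feasible tau x)
  (x_nonstat : ~ stationary tau phi x)
  (j : 'I_n) (j_max : j \in J_l1 phi x)
  (Ahat : {set 'I_n}) (Ahat_sub : Ahat \subset active_l1 tau eps phi x) :
  feasible tau (xtilde phi x j Ahat) /\
  phi (xtilde phi x j Ahat) - phi x
    <= - C * L * norm2 (xtilde phi x j Ahat - x) ^+ 2.
Proof.
have jA : j \notin Ahat.
  apply/negP => /(fintype.subsetP Ahat_sub).
  exact/negP/notin_active_l1.
split; first exact: le_trans (norm1_xtilde_le _ _ jA) x_feas.
set d := xtilde phi x j Ahat - x.
(* The index [j] witnesses that [n] is positive. *)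
have n0 : 0 < n%:R :> R by rewrite ltr0n (leq_ltn_trans _ (ltn_ord j)).
have := descent x d L_gt0 phi_diff phi_lip; rewrite /d [x + _]addrC subrK -/d.
have := dotv_grad_xtilde_sub phi x jA; rewrite -/d => ->.
have := sqr_norm2_xtilde_sub_le phi x jA; rewrite -/d.
set D := norm2 d ^+ 2; set Q := \sum_(i in Ahat) _ ^+ 2.
set G := \sum_(i in Ahat) _ => DQ desc.
have D0 : 0 <= D by exact: sqr_ge0.
have QG : Q <= eps * tau ^+ 2 * G.
  rewrite mulr_sumr; apply: ler_sum => i /(fintype.subsetP Ahat_sub).
  exact: active_l1_decrease.
have K0 : 0 < L * (2 * C + 1) by rewrite mulr_gt0 //; lra.
have eps_le1 : eps * (tau ^+ 2 * n%:R * (L * (2 * C + 1))) <= 1.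
  have P0 : 0 < tau ^+ 2 * n%:R * L * (2 * C + 1).
    by rewrite -mulrA; apply: mulr_gt0 => //; rewrite !mulr_gt0.
  by move: eps_le; rewrite ler_pdivlMr // -mulrA.
have c0 : 0 < n%:R * (eps * tau ^+ 2) by rewrite !mulr_gt0.
have DG : D <= n%:R * (eps * tau ^+ 2) * G.
  by rewrite -mulrA (le_trans DQ) // ler_pM2l.
(* The sign of [G] is read off from [0 <= D <= c G] with [c > 0]; it is needed to multiply [eps_le1]
   by [G]. *)
have G0 : 0 <= G by rewrite -(pmulr_rge0 _ c0) (le_trans D0).
have DLG : L * (2 * C + 1) * D <= G.
  have := ler_wpM2l (ltW K0) DG; have := ler_wpM2r G0 eps_le1; lra.
(* Now [- G + L D <= - 2 C L D]: the [1] in [2 C + 1] absorbs the error [L D] of [descent], and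
   [C L D >= 0] weakens [2 C] to [C]. *)
have := mulr_ge0 (mulr_ge0 (ltW C_gt0) (ltW L_gt0)) D0; lra.
Qed.
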